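(* Let $\mathcal N=\{n_k:k\ge0\}$ be the set of values of a strictly increasing sequence $(n_k)_{k\ge0}$ of positive integers (with $n_0=1$ not required). For $B,t>0$ set $$h_{\mathcal N}(B,t):=\max\{|1-e^{int}|:\ n\in\mathcal N,\ nt\le B\},$$ where the maximum of the empty set is $0$, and $$\alpha(\mathcal N):=\lim_{B\to\infty}\liminf_{t\downarrow0}h_{\mathcal N}(B,t).$$ Fix $1<q<2$. The following assertions are equivalent. (1) For every complex Banach space $X$ and every power bounded operator $T\in\mathcal B(X)$, the conditions $$\sup_{n\in\mathcal N}\|I-T^n\|\le q,\qquad\sigma(T)\cap\mathbb T\subset\{1\}$$ imply that $T$ is a Ritt operator. (2) The same implication holds for every normal contraction $T$ on $\ell^2$. (3) $q<\alpha(\mathcal N)$.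
   Context: $\mathbb D$ is the open unit disc, $\mathbb T$ the unit circle. A bounded operator $T$ on a complex Banach space is power bounded if $\sup_{n\ge0}\|T^n\|<\infty$, and a Ritt operator if $\sigma(T)\subset\overline{\mathbb D}$ and $\sup_{|\lambda|>1}|\lambda-1|\,\|(\lambda-T)^{-1}\|<\infty$. The limit as $B\to\infty$ defining $\alpha(\mathcal N)$ exists by monotonicity in $B$. Here $\ell^2$ is the complex Hilbert space of square-summable sequences. *)

(* Defs.v *)
From HB Require Import structures.
From mathcomp Require Import all_boot all_order all_algebra finmap.
From mathcomp Require Import all_classical all_reals all_analysis.
From mathcomp Require Import complex.
From mathcomp Require Import ring lra.

Set Implicit Arguments.
Unset Strict Implicit.
Unset Printing Implicit Defensive.

Import Order.TTheory GRing.Theory Num.Theory.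
Import numFieldNormedType.Exports.

Local Open Scope classical_set_scope.
Local Open Scope ring_scope.
Local Open Scope complex_scope.

(* The library equips the generic regular module K^o with its topology and
   norm; this makes the same structure available on the key R[i]. *)
HB.instance Definition _ (R : realType) := NormedModule.copy R[i] R[i]^o.

(* The norm of a normed module over R[i] takes its values in R[i]; since they
   are nonnegative reals, taking the real part loses nothing (rnormK). *)
Definition rnorm (R : realType) (V : normedModType R[i]) (x : V) : R :=
  complex.Re `|x|.

Section rnorm_theory.
Variables (R : realType) (V : normedModType R[i]).
Implicit Types x y : V.

Lemma rnormK x : (rnorm x)%:C = `|x|.
Proof. by rewrite /rnorm RRe_real// normr_real. Qed.

Lemma rnorm_ge0 x : 0 <= rnorm x.
Proof. by rewrite -ler0c rnormK. Qed.

Lemma rnormD x y : rnorm (x + y) <= rnorm x + rnorm y.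
Proof. by rewrite -lecR rmorphD/= !rnormK ler_normD. Qed.

Lemma rnormN x : rnorm (- x) = rnorm x.
Proof. by rewrite /rnorm normrN. Qed.

Lemma rnormZ (a : R[i]) x : rnorm (a *: x) = rnorm a * rnorm x.
Proof. by apply: complexI; rewrite rmorphM/= !rnormK normrZ. Qed.

Lemma rnorm_eq0 x : rnorm x = 0 -> x = 0.
Proof. by move=> x0; apply/eqP; rewrite -normr_eq0 -rnormK x0. Qed.

Lemma rnorm0 : rnorm (0 : V) = 0.
Proof. by apply: complexI; rewrite rnormK normr0. Qed.

End rnorm_theory.

Section ell2.
Variable R : realType.
Implicit Types (x y : nat -> R[i]).

Definition sqnorm x : \bar R := (\sum_(n <oo) (rnorm (x n) ^+ 2)%:E)%E.

Definition ell2_pred : {pred nat -> R[i]} := [pred x | (sqnorm x < +oo)%E].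

Let sq_ge0 x n : (0 <= (rnorm (x n) ^+ 2)%:E)%E.
Proof. by rewrite lee_fin sqr_ge0. Qed.

Lemma sqnorm_ge0 x : (0 <= sqnorm x)%E.
Proof. by apply: nneseries_ge0 => n _ _; exact: sq_ge0. Qed.

Lemma sqnorm_fin x : x \in ell2_pred -> sqnorm x \is a fin_num.
Proof. by rewrite inE => xl; rewrite ge0_fin_numE ?sqnorm_ge0. Qed.

Lemma sqnorm_partial x k :
  ((\sum_(0 <= n < k) rnorm (x n) ^+ 2)%:E <= sqnorm x)%E.
Proof.
by rewrite -sumEFin; apply: nneseries_lim_ge => n _ _; exact: sq_ge0.
Qed.

Lemma sqnorm_term x n : ((rnorm (x n) ^+ 2)%:E <= sqnorm x)%E.
Proof.
apply: le_trans (sqnorm_partial x n.+1); rewrite lee_fin big_nat_recr//=.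
by rewrite lerDr sumr_ge0// => i _; exact: sqr_ge0.
Qed.

Lemma sqnorm_le x (c : R) :
  (forall k, \sum_(0 <= n < k) rnorm (x n) ^+ 2 <= c) -> (sqnorm x <= c%:E)%E.
Proof.
move=> xc; apply: lime_le.
  by apply: is_cvg_nneseries => n _ _; exact: sq_ge0.
by apply: nearW => k; rewrite sumEFin lee_fin.
Qed.

Lemma sqnormZ a x : sqnorm (a *: x) = ((rnorm a ^+ 2)%:E * sqnorm x)%E.
Proof.
rewrite /sqnorm -nneseriesZl; last by move=> n _; exact: sq_ge0.
by apply: eq_eseriesr => n _; rewrite -EFinM -exprMn -rnormZ.
Qed.

Lemma sqnorm0 : sqnorm 0 = 0%E.
Proof. by rewrite -(scale0r 0) sqnormZ rnorm0 expr0n/= mul0e. Qed.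

Lemma sqnormD (c : R) x y : 0 < c ->
  (sqnorm (x + y)%R <= (1 + c)%:E * sqnorm x + (1 + c^-1)%:E * sqnorm y)%E.
Proof.
move=> c0; have cV0 : 0 < c^-1 by rewrite invr_gt0.
rewrite /sqnorm -!nneseriesZl; do ?by move=> n _; exact: sq_ge0.
rewrite -nneseriesD; last 2 first.
- by move=> n _; rewrite -EFinM lee_fin mulr_ge0 ?sqr_ge0// addr_ge0// ltW.
- by move=> n _; rewrite -EFinM lee_fin mulr_ge0 ?sqr_ge0// addr_ge0// ltW.
apply: lee_nneseries => n _; first by rewrite lee_fin sqr_ge0.
rewrite -!EFinM -EFinD lee_fin.
apply: (@le_trans _ _ ((rnorm (x n) + rnorm (y n)) ^+ 2)).
  by rewrite lerXn2r ?nnegrE ?addr_ge0 ?rnorm_ge0//; exact: rnormD.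
set a := rnorm (x n); set b := rnorm (y n).
rewrite -subr_ge0.
suff -> : (1 + c) * a ^+ 2 + (1 + c^-1) * b ^+ 2 - (a + b) ^+ 2 =
    c^-1 * (c * a - b) ^+ 2 by rewrite mulr_ge0 ?sqr_ge0// ltW.
by field; rewrite gt_eqF.
Qed.

Lemma ell2_submod_closed : submod_closed ell2_pred.
Proof.
split=> [|a x y]; first by rewrite inE sqnorm0.
move=> xl yl; rewrite inE; apply: le_lt_trans (sqnormD _ _ ltr01) _.
rewrite sqnormZ -(fineK (sqnorm_fin xl)) -(fineK (sqnorm_fin yl)).
by rewrite -!EFinM -EFinD ltry.
Qed.

HB.instance Definition _ := GRing.isSubmodClosed.Build R[i] (nat -> R[i])
  ell2_pred ell2_submod_closed.

Record ell2 := Ell2 { ell2_seq :> nat -> R[i]; _ : ell2_seq \in ell2_pred }.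

HB.instance Definition _ := [isSub of ell2 for ell2_seq].
HB.instance Definition _ := [Choice of ell2 by <:].
HB.instance Definition _ := [SubChoice_isSubLmodule of ell2 by <:].

Definition ell2_norm (x : ell2) : R := Num.sqrt (fine (sqnorm x)).

Lemma ell2_normK (x : ell2) : (ell2_norm x ^+ 2)%:E = sqnorm x.
Proof.
by rewrite sqr_sqrtr ?fine_ge0 ?sqnorm_ge0// fineK// sqnorm_fin// (valP x).
Qed.

Lemma ell2_norm_ge0 (x : ell2) : 0 <= ell2_norm x.
Proof. exact: sqrtr_ge0. Qed.

Lemma ell2_norm_eq0 (x : ell2) : ell2_norm x = 0 -> x = 0.
Proof.
move=> x0; apply/val_inj/funext => n /=; apply: rnorm_eq0.
have := sqnorm_term x n; rewrite -ell2_normK x0 expr0n/= lee_fin => h.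
by apply/eqP; rewrite -sqrf_eq0 eq_le h sqr_ge0.
Qed.

Lemma ell2_normD (x y : ell2) :
  ell2_norm (x + y) <= ell2_norm x + ell2_norm y.
Proof.
have [x0|x0] := eqVneq (ell2_norm x) 0.
  by rewrite (ell2_norm_eq0 x0) add0r lerDr ell2_norm_ge0.
have [y0|y0] := eqVneq (ell2_norm y) 0.
  by rewrite (ell2_norm_eq0 y0) addr0 lerDl ell2_norm_ge0.
have a0 : 0 < ell2_norm x by rewrite lt0r x0 ell2_norm_ge0.
have b0 : 0 < ell2_norm y by rewrite lt0r y0 ell2_norm_ge0.
rewrite -(@ler_pXn2r _ 2)// ?nnegrE ?addr_ge0 ?ell2_norm_ge0//.
have := sqnormD x y (divr_gt0 b0 a0).
rewrite -!ell2_normK -!EFinM -EFinD.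
rewrite -[sqnorm _]/(sqnorm (x + y : ell2)) -ell2_normK lee_fin.
move=> /le_trans; apply; rewrite le_eqVlt; apply/orP; left; apply/eqP.
by field; rewrite x0.
Qed.

Lemma ell2_normZ (a : R[i]) (x : ell2) :
  ell2_norm (a *: x) = rnorm a * ell2_norm x.
Proof.
apply/eqP; rewrite -(@eqrXn2 _ 2)// ?mulr_ge0 ?ell2_norm_ge0 ?rnorm_ge0//.
apply/eqP/EFin_inj; rewrite ell2_normK exprMn EFinM ell2_normK.
exact: sqnormZ.
Qed.

Let ler_normD (x y : ell2) :
  (ell2_norm (x + y))%:C <= (ell2_norm x)%:C + (ell2_norm y)%:C.
Proof. by rewrite -rmorphD lecR ell2_normD. Qed.

Let normrZ (a : R[i]) (x : ell2) :
  (ell2_norm (a *: x))%:C = `|a| * (ell2_norm x)%:C.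
Proof. by rewrite ell2_normZ rmorphM/= rnormK. Qed.

Let normr0_eq0 (x : ell2) : (ell2_norm x)%:C = 0 -> x = 0.
Proof. by move=> /(@complexI _ _ 0); exact: ell2_norm_eq0. Qed.

HB.instance Definition _ := Lmodule_isNormed.Build R[i] ell2
  ler_normD normrZ normr0_eq0.

Lemma ell2_normE (x : ell2) : `|x| = (ell2_norm x)%:C. Proof. by []. Qed.

Lemma ell2_coord (x : ell2) n : rnorm (x n) <= ell2_norm x.
Proof.
rewrite -(@ler_pXn2r _ 2) ?nnegrE ?rnorm_ge0 ?ell2_norm_ge0//.
by rewrite -lee_fin ell2_normK sqnorm_term.
Qed.

Lemma rnormC2 (z : R[i]) :
  rnorm z ^+ 2 = complex.Re z ^+ 2 + complex.Im z ^+ 2.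
Proof. by apply: complexI; rewrite rmorphXn/= rnormK -add_Re2_Im2. Qed.

Let ell2_complete (F : set_system ell2) : ProperFilter F -> cauchy F -> cvg F.
Proof.
move=> FF Fc.
have {}Fc (e : R) : 0 < e -> exists z, \forall y \near F, ell2_norm (z - y) < e.
  move=> e0; have eC0 : 0 < e%:C by rewrite ltcR.
  have [z Fz] := (iffLR (cauchyP F) Fc) _ eC0.
  exists z; apply: filterS Fz => y.
  by rewrite -ball_normE/= ell2_normE ltcR.
have cvgc (p : R[i] -> R) n :
    (forall a b, p (a - b) = p a - p b) -> (forall a, `|p a| <= rnorm a) ->
    cvg ((fun y : ell2 => p (y n)) @ F).
  move=> pB pn; apply/cauchy_cvgP/cauchyP => e e0.
  have [z Fz] := Fc _ e0; exists (p (z n)).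
  apply: filterS Fz => y zy; rewrite -ball_normE/= -pB.
  exact: le_lt_trans (le_trans (pn _) (ell2_coord (z - y) n)) zy.
have cRe n : cvg ((fun y : ell2 => complex.Re (y n)) @ F).
  apply: cvgc; first by move=> [a b] [c d].
  move=> a; rewrite -(@ler_pXn2r _ 2) ?nnegrE ?rnorm_ge0 ?normr_ge0//.
  by rewrite rnormC2 real_normK ?num_real// lerDl sqr_ge0.
have cIm n : cvg ((fun y : ell2 => complex.Im (y n)) @ F).
  apply: cvgc; first by move=> [a b] [c d].
  move=> a; rewrite -(@ler_pXn2r _ 2) ?nnegrE ?rnorm_ge0 ?normr_ge0//.
  by rewrite rnormC2 real_normK ?num_real// lerDr sqr_ge0.
pose x : nat -> R[i] := fun n =>
  (lim ((fun y : ell2 => complex.Re (y n)) @ F) : R) +i*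
  (lim ((fun y : ell2 => complex.Im (y n)) @ F) : R).
have near_x (e : R) (z : ell2) : 0 < e ->
    (\forall y \near F, ell2_norm (z - y) < e) ->
    (sqnorm ((z : nat -> R[i]) - x)%R <= (e ^+ 2)%:E)%E.
  move=> e0 zF; apply: sqnorm_le => k.
  apply: (cvgr_to_le (F := F)
    (f := fun y : ell2 => \sum_(0 <= n < k) rnorm (z n - y n) ^+ 2)); last first.
    apply: filterS zF => y zy; rewrite -lee_fin.
    apply: (le_trans (sqnorm_partial (z - y : ell2) k)).
    by rewrite -ell2_normK lee_fin ler_pXn2r ?nnegrE ?ell2_norm_ge0// ltW.
  apply: cvg_big => [|n _]; first exact: add_continuous.
  rewrite rnormC2 (_ : (fun _ => _) = (fun y : ell2 =>
    (complex.Re (z n) - complex.Re (y n)) ^+ 2 +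
    (complex.Im (z n) - complex.Im (y n)) ^+ 2)); last first.
    by apply/funext => y; rewrite rnormC2; case: (z n) (y n) => [? ?] [? ?].
  rewrite (_ : complex.Re (z n - x n) =
      complex.Re (z n) - complex.Re (x n)); last by case: (z n).
  rewrite (_ : complex.Im (z n - x n) =
      complex.Im (z n) - complex.Im (x n)); last by case: (z n).
  apply: cvgD; rewrite !expr2.
    by apply: cvgM; apply: cvgB; [exact: cvg_cst|exact: cRe
                                 |exact: cvg_cst|exact: cRe].
  by apply: cvgM; apply: cvgB; [exact: cvg_cst|exact: cIm
                               |exact: cvg_cst|exact: cIm].
have xl : x \in ell2_pred.
  have [z Fz] := Fc _ ltr01.
  rewrite -[x](subKr (z : nat -> R[i])) rpredB//; first exact: (valP z).
  by rewrite inE (le_lt_trans (near_x _ _ ltr01 Fz)) ?ltry.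
apply/cvg_ex; exists (Ell2 xl); apply/cvgrPdist_le => -[e i].
rewrite ltcE/= => /andP[/eqP -> {i} e0].
have e20 : 0 < e / 2 by rewrite divr_gt0.
have [z Fz] := Fc _ e20.
apply: filterS (Fz) => y zy; rewrite ell2_normE lecR.
rewrite -(subrK z (Ell2 xl)) -addrA (le_trans (ell2_normD _ _))//.
rewrite [leRHS]splitr lerD//; last exact: ltW.
rewrite -(@ler_pXn2r _ 2) ?nnegrE ?ell2_norm_ge0 ?(ltW e20)//.
rewrite -lee_fin ell2_normK; apply: le_trans (near_x _ _ e20 Fz).
rewrite le_eqVlt; apply/orP; left; apply/eqP.
by apply: eq_eseriesr => n _; rewrite -[in RHS]rnormN opprB.
Qed.

HB.instance Definition _ := Uniform_isComplete.Build ell2 ell2_complete.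

End ell2.

Section operators.
Variables (R : realType) (X : normedModType R[i]).
Implicit Types (A S T : X -> X) (l : R[i]).

(* The supremum is taken in \bar R, so that a linear map is bounded iff its
   norm is < +oo. *)
Definition opnorm A : \bar R :=
  ereal_sup [set (rnorm (A x))%:E | x in [set x : X | rnorm x <= 1]].

Definition bounded_op A : Prop := linear A /\ (opnorm A < +oo)%E.

Definition inverse_op A S : Prop := [/\ bounded_op S, cancel A S & cancel S A].

Definition spectrum T : set R[i] :=
  [set l | ~ exists S, inverse_op (fun x => l *: x - T x) S].

(* (l - T)^-1, with the junk value 0 when l is in the spectrum of T *)
Definition resolvent T l : X -> X :=
  xget (fun=> 0) [set S | inverse_op (fun x => l *: x - T x) S].

Definition power_bounded T : Prop :=
  (ereal_sup [set opnorm (iter n T) | n in [set: nat]] < +oo)%E.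

Definition ritt T : Prop :=
  spectrum T `<=` [set l | rnorm l <= 1] /\
  (ereal_sup [set (rnorm (l - 1)%R)%:E * opnorm (resolvent T l)
             | l in [set l : R[i] | (1 < rnorm l)%R]] < +oo)%E.

Definition ritt_criterion (N : set nat) (q : R) T : Prop :=
  (ereal_sup [set opnorm (fun x => (x - iter n T x)%R) | n in N] <= q%:E)%E ->
  spectrum T `&` [set l | rnorm l = 1] `<=` [set 1] ->
  ritt T.

End operators.

(* The series is absolutely convergent for square-summable x and y. *)
Definition ell2_dot (R : realType) (x y : ell2 R) : R[i] :=
  limn (series (fun n => x n * (y n)^*)).

(* S is the adjoint of T. *)
Definition normal_op (R : realType) (T : ell2 R -> ell2 R) : Prop :=
  exists S : ell2 R -> ell2 R,
    [/\ bounded_op S, forall x y, ell2_dot (T x) y = ell2_dot x (S y)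
      & T \o S = S \o T].

Definition expi (R : realType) (t : R) : R[i] := cos t +i* sin t.

(* For t > 0 the index set is finite, so that fset_set enumerates it. *)
Definition hN (R : realType) (N : set nat) (B t : R) : R :=
  \big[Num.max/0]_(n <- fset_set [set n | N n /\ n%:R * t <= B])
    rnorm (1 - expi (n%:R * t)).

(* The limit exists in \bar R since hN is nondecreasing in B. *)
Definition alpha (R : realType) (N : set nat) : \bar R :=
  lim (limf_einf (fun t : R => (hN N B t)%:E) 0^'+ @[B --> +oo%R]).

(* Main.v *)
Require Import Defs.
From HB Require Import structures.
From mathcomp Require Import all_boot all_order all_algebra finmap.
From mathcomp Require Import all_classical all_reals all_analysis.
From mathcomp Require Import complex.
From mathcomp Require Import ring lra.

Set Implicit Arguments.
Unset Strict Implicit.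
Unset Printing Implicit Defensive.

Import Order.TTheory GRing.Theory Num.Theory.
Import numFieldNormedType.Exports.

Local Open Scope classical_set_scope.
Local Open Scope ring_scope.
Local Open Scope complex_scope.

(** Write [|x|] for [rnorm x], and fix a power bounded [T] with bound [M].

    If [alpha N > q], there are [B] and [c > q] such that every small [t > 0]
    admits [n] in [N] with [n * t <= B] and [|1 - expi (n * t)| > c].  Suppose
    that the resolvent estimate fails badly at a point [l] near 1 with
    [|l| > 1]: some [x] satisfies [|(l - T) x| < e * |l - 1| * |x|] with [e]
    small.  Power boundedness gives [(|l| - 1) * |x| <= M * |(l - T) x|], so
    [l] approaches 1 tangentially to the circle and may be replaced by
    [expi t] with [t = Im l].  Telescoping shows that [T ^ n x] differs from
    [expi (n * t) *: x] by at most [M * B] times a small multiple of [|x|] as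
    long as [n * |t| <= B]; choosing [n] in [N] as above makes
    [|x - T ^ n x|] larger than [q * |x|] ([lower_bound_near_one]).  Away from
    1 the spectral hypothesis and compactness provide the estimate
    ([ritt_of_escape]).  Only lower bounds for [l - T] are manipulated; they
    become resolvent bounds because, for [|l| > 1], an operator that is
    bounded below and has dense range is invertible
    ([inverse_of_bounded_below]).

    Conversely, if [alpha N <= q], then for every [s > 0] and
    [B = 1 / (s * (q - 1))] there are arbitrarily small [t] for which
    [|1 - expi (n * t)|] is less than [q + s * (q - 1)] whenever [n] is in [N]
    and [n * t <= B].  The number [expi t / (1 + s * t)] then has all its
    powers with exponents in [N] within [q] of 1, since the decay of the
    modulus absorbs the excess [s * (q - 1)] up to [B] and brings the modulus
    below [q - 1] after [B] ([spiral_powers_near1]).  The diagonal operator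
    with such eigenvalues for a sequence of values of [s] tending to 0 is a
    normal contraction whose spectrum meets the circle only at 1, and it is
    not Ritt because its eigenvalues approach 1 tangentially
    ([spiral_not_ritt]). *)

(** * The modulus on the complex numbers *)

Section modulus.
Variable R : realType.
Implicit Types (a b z : R[i]) (x t : R).

Lemma rnormM a b : rnorm (a * b) = rnorm a * rnorm b.
Proof. exact: (@rnormZ R R[i] a b). Qed.

Lemma rnorm1 : rnorm (1 : R[i]) = 1.
Proof. by rewrite /rnorm normr1. Qed.

Lemma rnormX a n : rnorm (a ^+ n) = rnorm a ^+ n.
Proof. by elim: n => [|n IHn]; rewrite ?expr0 ?rnorm1// !exprS rnormM IHn. Qed.

Lemma rnormV a : rnorm a^-1 = (rnorm a)^-1.
Proof. by rewrite /rnorm normfV -rnormK -fmorphV. Qed.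

Lemma rnorm_real x : rnorm x%:C = `|x|.
Proof.
apply/eqP; rewrite -(@eqrXn2 _ 2)// ?rnorm_ge0//.
by rewrite rnormC2/= expr0n addr0 real_normK ?num_real.
Qed.

Lemma rnorm_conj z : rnorm z^* = rnorm z.
Proof.
apply/eqP; rewrite -(@eqrXn2 _ 2)// ?rnorm_ge0// !rnormC2.
by case: z => u v /=; rewrite sqrrN.
Qed.

Lemma rnorm_gt0 (V : normedModType R[i]) (v : V) : (0 < rnorm v) = (v != 0).
Proof.
rewrite lt0r rnorm_ge0 andbT; congr negb; apply/eqP/eqP => [/rnorm_eq0//|->].
exact: rnorm0.
Qed.

Lemma rnormB_sym (V : normedModType R[i]) (u v : V) :
  rnorm (u - v) = rnorm (v - u).
Proof. by rewrite -rnormN opprB. Qed.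

Lemma rnormB (V : normedModType R[i]) (u v : V) :
  rnorm (u - v) <= rnorm u + rnorm v.
Proof. by rewrite -(rnormN v); exact: rnormD. Qed.

Lemma rnorm_triangle (V : normedModType R[i]) (u v w : V) :
  rnorm (u - w) <= rnorm (u - v) + rnorm (v - w).
Proof. by rewrite -[u - w](subrKA v); exact: rnormD. Qed.

Lemma lerB_rnorm (V : normedModType R[i]) (u v : V) :
  rnorm u - rnorm v <= rnorm (u - v).
Proof. by rewrite lerBlDr -{1}[u](subrK v) rnormD. Qed.

Lemma rnormE_Re_Im z : rnorm z <= `|complex.Re z| + `|complex.Im z|.
Proof.
rewrite -(@ler_pXn2r _ 2) ?nnegrE ?addr_ge0 ?rnorm_ge0// rnormC2.
rewrite sqrrD !real_normK ?num_real// addrAC lerDl.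
by rewrite mulrn_wge0// mulr_ge0.
Qed.

Lemma ler_Re_rnorm z : `|complex.Re z| <= rnorm z.
Proof.
rewrite -(@ler_pXn2r _ 2) ?nnegrE ?rnorm_ge0// rnormC2.
by rewrite real_normK ?num_real// lerDl sqr_ge0.
Qed.

Lemma ler_Im_rnorm z : `|complex.Im z| <= rnorm z.
Proof.
rewrite -(@ler_pXn2r _ 2) ?nnegrE ?rnorm_ge0// rnormC2.
by rewrite real_normK ?num_real// lerDr sqr_ge0.
Qed.

Lemma rnorm_expi t : rnorm (expi t) = 1.
Proof.
apply/eqP; rewrite -(@eqrXn2 _ 2)// ?rnorm_ge0// rnormC2/= expr1n.
by rewrite cos2Dsin2.
Qed.

Lemma expiX t n : expi t ^+ n = expi (n%:R * t).
Proof.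
elim: n => [|n IHn].
  by rewrite expr0 mul0r /expi cos0 sin0.
rewrite exprS IHn -natr1 mulrDl mul1r /expi cosD sinD.
by apply/eqP; rewrite eq_complex/=; apply/andP; split; apply/eqP; ring.
Qed.

Lemma rnorm_1Bexpi_norm t : rnorm (1 - expi `|t|) = rnorm (1 - expi t).
Proof.
have [t0|t0] := leP 0 t; first by rewrite ger0_norm.
rewrite ltr0_norm// -rnorm_conj; congr rnorm.
by apply/eqP; rewrite eq_complex/= cosN sinN; apply/andP; split; apply/eqP; ring.
Qed.

Lemma ler_sin_norm x : `|sin x| <= `|x|.
Proof.
have pos (y : R) : 0 <= y -> `|sin y| <= y.
  move=> y0.
  have [|c _] := @MVT_segment R sin cos 0 y y0 (fun u _ => is_derive_sin u).
    exact/continuous_subspaceT/continuous_sin.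
  rewrite sin0 !subr0 => ->; rewrite normrM (ger0_norm y0) -[leRHS]mul1r.
  by rewrite ler_wpM2r// cos_max.
have [x0|x0] := leP 0 x; first by rewrite (ger0_norm x0) pos.
by rewrite (ltr0_norm x0) -normrN -sinN pos// oppr_ge0 ltW.
Qed.

Lemma cos_ge x : 1 - x ^+ 2 / 2 <= cos x.
Proof.
have -> : cos x = 1 - (sin (x / 2)) ^+ 2 *+ 2.
  rewrite {1}[x]splitr -mulr2n cos_mulr2n cos2sin2 -[X in X = _]/(_ - _); ring.
have : sin (x / 2) ^+ 2 <= (x / 2) ^+ 2.
  by rewrite -[leLHS]real_normK ?num_real// -[leRHS]real_normK ?num_real//
    lerXn2r ?nnegrE// ler_sin_norm.
have -> : (x / 2) ^+ 2 = x ^+ 2 / 4 by field.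
rewrite -mulr_natl; lra.
Qed.

Lemma rnorm_1Bexpi_le t : rnorm (1 - expi t) <= `|t|.
Proof.
rewrite -(@ler_pXn2r _ 2) ?nnegrE ?rnorm_ge0// real_normK ?num_real//.
rewrite rnormC2 /=; have := cos_ge t; have := cos2Dsin2 t; nra.
Qed.

Lemma sin_ge t : 0 <= t -> t - t ^+ 3 / 2 <= sin t.
Proof.
move=> t0.
have [|c] := @MVT_segment R sin cos 0 t t0 (fun u _ => is_derive_sin u).
  exact/continuous_subspaceT/continuous_sin.
rewrite in_itv/= => /andP[c0 ct]; rewrite sin0 !subr0 => ->.
have ccos := cos_ge c.
have c2 : c ^+ 2 <= t ^+ 2 by rewrite lerXn2r ?nnegrE.
have -> : t - t ^+ 3 / 2 = (1 - t ^+ 2 / 2) * t by ring.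
by rewrite ler_wpM2r//; lra.
Qed.

Lemma ler_norm_subr_sin t : `|t| <= 1 -> `|t - sin t| <= t ^+ 2.
Proof.
have pos (y : R) : 0 <= y <= 1 -> `|y - sin y| <= y ^+ 2.
  move=> /andP[y0 y1].
  have := ler_sin_norm y; rewrite (ger0_norm y0) ler_norml => /andP[_ sy].
  rewrite ger0_norm ?subr_ge0//; have := sin_ge y0.
  have : y ^+ 3 <= y ^+ 2 by rewrite ler_wiXn2l.
  have := exprn_ge0 3 y0; lra.
have [t0|t0] := leP 0 t.
  by rewrite (ger0_norm t0) => t1; rewrite pos ?t0.
rewrite (ltr0_norm t0) => t1; rewrite -sqrrN -normrN opprD -sinN pos//.
by rewrite oppr_ge0 ltW.
Qed.

End modulus.

(** * Bounded operators and their inverses *)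

Section bounded_operators.
Variables (R : realType) (X : normedModType R[i]).
Implicit Types (A S T : X -> X) (l m : R[i]) (x y : X).

(** Gives access to the theory of linear maps for an operator whose linearity
    is only a hypothesis. *)
Lemma linear_bundle A : linear A -> exists f : {linear X -> X}, A = f.
Proof.
move=> lA; pose lin := GRing.isLinear.Build R[i] X X *:%R A lA.
by exists (HB.pack_for {linear X -> X} A lin).
Qed.

Lemma linear_iter T n : linear T -> linear (iter n T).
Proof. by move=> lT; elim: n => [|n IHn] a x y //=; rewrite IHn lT. Qed.

Lemma linear_lB T l : linear T -> linear (fun x => l *: x - T x).
Proof.
move=> /linear_bundle[f ->] a x y.
by rewrite linearP scalerDr scalerBr !scalerA mulrC opprD addrACA.
Qed.

Lemma opnorm_ge0 A : linear A -> (0 <= opnorm A)%E.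
Proof.
move=> /linear_bundle[f ->]; apply: ereal_sup_ubound.
by exists 0; rewrite /= ?linear0 ?rnorm0.
Qed.

Lemma opnorm_le A (c : R) : 0 <= c ->
  (forall x, rnorm (A x) <= c * rnorm x) -> (opnorm A <= c%:E)%E.
Proof.
move=> c0 Ac; apply: ge_ereal_sup => _ [x /= x1 <-].
by rewrite lee_fin (le_trans (Ac x))// ler_piMr.
Qed.

Lemma opnorm_bound A (c : R) x : linear A ->
  (opnorm A <= c%:E)%E -> rnorm (A x) <= c * rnorm x.
Proof.
move=> /linear_bundle[f ->] fc; have [->|x0] := eqVneq x 0.
  by rewrite linear0 rnorm0 mulr0.
have nx0 : 0 < rnorm x by rewrite rnorm_gt0.
rewrite -ler_pdivrMr// mulrC.
have -> : (rnorm x)^-1 * rnorm (f x) = rnorm (f ((rnorm x)^-1%:C *: x)).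
  by rewrite linearZ rnormZ rnorm_real ger0_norm// invr_ge0 ltW.
rewrite -lee_fin; apply: le_trans fc; apply: ereal_sup_ubound.
exists ((rnorm x)^-1%:C *: x) => //=.
by rewrite rnormZ rnorm_real ger0_norm ?invr_ge0 ?(ltW nx0)// mulVf ?gt_eqF.
Qed.

Lemma bounded_op_intro A (c : R) : linear A -> 0 <= c ->
  (forall x, rnorm (A x) <= c * rnorm x) -> bounded_op A.
Proof.
by move=> lA c0 Ac; split=> //; exact: le_lt_trans (opnorm_le c0 Ac) (ltry _).
Qed.

Lemma bounded_op_bound A : bounded_op A ->
  exists2 c : R, 0 < c & forall x, rnorm (A x) <= c * rnorm x.
Proof.
move=> [lA Aoo]; exists (fine (opnorm A) + 1).
  by rewrite ltr_wpDl// fine_ge0// opnorm_ge0.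
move=> x; apply: opnorm_bound => //.
rewrite EFinD fineK ?leeDl ?lee_fin//.
by rewrite ge0_fin_numE ?opnorm_ge0.
Qed.

Lemma power_bounded_intro T (c : R) : 0 <= c ->
  (forall n x, rnorm (iter n T x) <= c * rnorm x) -> power_bounded T.
Proof.
move=> c0 Tc; apply: le_lt_trans (ltry c); apply: ge_ereal_sup => _ [n _ <-].
exact: opnorm_le.
Qed.

Lemma power_bounded_bound T : linear T -> power_bounded T ->
  exists2 c : R, 0 < c & forall n x, rnorm (iter n T x) <= c * rnorm x.
Proof.
move=> lT; rewrite /power_bounded; set s := ereal_sup _ => soo.
have ns n : (opnorm (iter n T) <= s)%E by apply: ereal_sup_ubound; exists n.
have s0 : (0 <= s)%E := le_trans (opnorm_ge0 (linear_iter 0 lT)) (ns 0%N).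
have sfin : s \is a fin_num by rewrite ge0_fin_numE.
exists (fine s + 1); first by rewrite ltr_wpDl// fine_ge0.
move=> n x; apply: opnorm_bound; first exact: linear_iter.
by rewrite (le_trans (ns n))// EFinD fineK// leeDl ?lee_fin.
Qed.

Lemma resolventP T l : ~ spectrum T l ->
  inverse_op (fun x => l *: x - T x) (resolvent T l).
Proof. by move=> /contrapT[S TS]; apply: xgetPex; exists S. Qed.

End bounded_operators.

Section completeness.
Variables (R : realType) (X : completeNormedModType R[i]).
Implicit Types (A S T : X -> X) (l m : R[i]) (x y : X) (e c : R).

Lemma rnorm_cauchy_cvg (u : nat -> X) :
  (forall e, 0 < e ->
    exists k, forall i, (k <= i)%N -> rnorm (u i - u k) <= e) ->
  exists x, forall e, 0 < e ->
    exists k, forall i, (k <= i)%N -> rnorm (u i - x) <= e.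
Proof.
move=> uc; have /cauchy_cvgP /cvg_ex[x ux] : cauchy (u @ \oo).
  apply/cauchyP => -[e i]; rewrite ltcE/= => /andP[/eqP -> {i} e0].
  have [k uk] := uc (e / 2) (divr_gt0 e0 (ltr0n _ 2)).
  exists (u k); exists k => // i /= /uk ki.
  rewrite -ball_normE/= -rnormK ltcR rnormB_sym (le_lt_trans ki)//.
  by rewrite ltr_pdivrMr// ltr_pMr// ltr1n.
exists x => e e0; have e0C : 0 < e%:C by rewrite ltcR.
have /cvgrPdist_le/(_ _ e0C) [k _ kx] := ux.
exists k => i /kx /=; rewrite -rnormK lecR; by rewrite rnormB_sym.
Qed.

(** The inverse on the range of an operator that is bounded below is Lipschitz,
    so preimages of approximations of a vector form a Cauchy sequence; hence
    a dense range is the whole space. *)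
Lemma inverse_of_bounded_below A c : bounded_op A -> 0 < c ->
  (forall x, c * rnorm x <= rnorm (A x)) ->
  (forall y e, 0 < e -> exists x, rnorm (A x - y) <= e) ->
  exists S, inverse_op A S.
Proof.
move=> bA c0 Ac dense; have [lA _] := bA.
have [C C0 AC] := bounded_op_bound bA.
have [f fE] := linear_bundle lA; rewrite {lA}fE in bA Ac dense AC *.
have lipV x y : rnorm (x - y) <= c^-1 * rnorm (f x - f y).
  by rewrite -linearB mulrC ler_pdivlMr// mulrC.
have surj y : exists x, f x = y.
  have [u uy] : exists u : nat -> X, forall n, rnorm (f (u n) - y) <= n.+1%:R^-1.
    have H n : exists x, rnorm (f x - y) <= n.+1%:R^-1 by apply: dense.
    by have [u uP] := choice H; exists u.
  have small e : 0 < e ->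
      exists k, forall i, (k <= i)%N -> rnorm (f (u i) - y) <= e.
    move=> e0; have [k ke] : exists k : nat, e^-1 < k%:R.
      by exists (Num.truncn e^-1).+1; rewrite truncnS_gt.
    exists k => i ki; apply: le_trans (uy i) _.
    rewrite invf_ple ?posrE// (le_trans (ltW ke))// ler_nat.
    exact: leq_trans ki _.
  have [|x ux] := rnorm_cauchy_cvg (u := u).
    move=> e e0; have e'0 : 0 < c * (e / 2) by rewrite mulr_gt0// divr_gt0.
    have [k ke] := small _ e'0; exists k => i ki.
    apply: le_trans (lipV _ _) _; rewrite mulrC ler_pdivrMr//.
    apply: (le_trans (rnorm_triangle _ y _)).
    rewrite (rnormB_sym y) (_ : e * c = c * (e / 2) + c * (e / 2)).
      by rewrite lerD ?ke.
    by field.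
  exists x; apply/eqP; rewrite -subr_eq0; apply/eqP/rnorm_eq0/eqP.
  rewrite eq_le rnorm_ge0 andbT; apply/ler_addgt0Pr => e e0; rewrite add0r.
  have e'0 : 0 < e / 2 / C by rewrite !divr_gt0.
  have e20 : 0 < e / 2 by rewrite divr_gt0.
  have [k1 k1P] := ux _ e'0; have [k2 k2P] := small _ e20.
  have k1m := leq_maxl k1 k2; have k2m := leq_maxr k1 k2.
  apply: (le_trans (rnorm_triangle _ (f (u (maxn k1 k2))) _)).
  rewrite [leRHS]splitr lerD ?k2P// -linearB (le_trans (AC _))// mulrC.
  by rewrite -ler_pdivlMr// rnormB_sym k1P.
have [S fS] := choice surj.
have inj x y : f x = f y -> x = y.
  move=> fxy; apply/eqP; rewrite -subr_eq0; apply/eqP/rnorm_eq0/eqP.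
  by rewrite eq_le rnorm_ge0 (le_trans (lipV _ _))// fxy subrr rnorm0 mulr0.
exists S; split=> [|x|//]; last by apply: inj; rewrite fS.
apply: (@bounded_op_intro _ _ _ c^-1); last 2 first.
- by rewrite invr_ge0 ltW.
- by move=> y; rewrite mulrC ler_pdivlMr// mulrC (le_trans (Ac _))// fS.
by move=> a x y; apply: inj; rewrite linearP !fS.
Qed.

End completeness.

(** * Resolvent estimates for power bounded operators *)

Section power_bounded_resolvent.
Variables (R : realType) (X : completeNormedModType R[i]).
Variables (T : X -> X) (M : R).
Hypothesis (lT : linear T) (M_gt0 : 0 < M).
Hypothesis TM : forall n x, rnorm (iter n T x) <= M * rnorm x.
Implicit Types (l : R[i]) (x y : X).

(** An approximate eigenvector of [T] stays one for the powers of [T]: expand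
    [T ^ n - l ^ n] as [(T - l)] times a geometric sum. *)
Lemma iter_approx_eigen l x n :
  rnorm (iter n T x - l ^+ n *: x) <=
  M * rnorm (l *: x - T x) * \sum_(k < n) rnorm l ^+ k.
Proof.
elim: n => [|n IHn].
  by rewrite /= expr0 scale1r subrr rnorm0 big_ord0 mulr0.
have -> : iter n.+1 T x - l ^+ n.+1 *: x =
    l *: (iter n T x - l ^+ n *: x) - iter n T (l *: x - T x).
  have [f fE] := linear_bundle (linear_iter n lT).
  rewrite iterSr fE [f (_ - _)]linearB [f (_ *: _)]linearZ/= scalerBr scalerA.
  by rewrite -exprS opprB [RHS]addrC subrKA.
apply: le_trans (rnormB _ _) _; rewrite rnormZ big_ord_recl expr0 mulrDr mulr1.
rewrite addrC lerD// (le_trans (ler_wpM2l (rnorm_ge0 _) IHn))//.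
rewrite mulrCA ler_wpM2l ?mulr_ge0 ?rnorm_ge0 ?(ltW M_gt0)// mulr_sumr.
by apply: ler_sum => k _; rewrite /= /bump/= add1n exprS.
Qed.

(** If [l - T] nearly annihilated [x], the vectors [T ^ n x] would grow like
    [l ^ n], because the geometric sum in [iter_approx_eigen] is at most
    [|l| ^ n / (|l| - 1)]. *)
Lemma power_bounded_below l x : 1 < rnorm l ->
  (rnorm l - 1) * rnorm x <= M * rnorm (l *: x - T x).
Proof.
set r := rnorm l; set d := M * _ => r1; have r1_gt0 : 0 < r - 1 by lra.
have d0 : 0 <= d by rewrite mulr_ge0 ?rnorm_ge0 ?ltW.
have key n : r ^+ n * ((r - 1) * rnorm x - d) <= (r - 1) * (M * rnorm x).
  have rn : r ^+ n * rnorm x - M * rnorm x <= d * \sum_(k < n) r ^+ k.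
    apply: le_trans (iter_approx_eigen l x n).
    rewrite rnormB_sym -rnormX -rnormZ.
    by apply: le_trans (lerB_rnorm _ _); rewrite lerD2l lerN2.
  have := ler_wpM2l (ltW r1_gt0) rn.
  rewrite [leRHS]mulrCA -subrX1; set u := r ^+ n; lra.
rewrite leNgt; apply/negP => dx.
have a0 : 0 < (r - 1) * rnorm x - d by rewrite subr_gt0.
set a := (r - 1) * rnorm x - d in key a0.
pose K := (r - 1) * (M * rnorm x) / a.
have rn n : n%:R * (r - 1) <= r ^+ n.
  elim: n => [|n IHn]; first by rewrite mul0r expr0 ler01.
  have := exprn_ege1 n (ltW r1); rewrite exprS -natr1; nra.
have : K < (Num.truncn (K / (r - 1))).+1%:R * (r - 1).
  by rewrite -ltr_pdivrMr// truncnS_gt.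
move=> /lt_le_trans/(_ (rn _)); rewrite ltNge ler_pdivlMr//.
by rewrite key.
Qed.

Lemma power_bounded_inverse l : 1 < rnorm l ->
  exists S, inverse_op (fun x => l *: x - T x) S.
Proof.
move=> l1; have l0 : l != 0.
  by rewrite -rnorm_gt0 (lt_trans ltr01).
have [f fE] := linear_bundle lT.
have bT x : rnorm (T x) <= M * rnorm x := TM 1 x.
apply: (inverse_of_bounded_below (c := (rnorm l - 1) / M)).
- apply: (bounded_op_intro (c := rnorm l + M)).
  + exact: linear_lB.
  + by rewrite addr_ge0 ?rnorm_ge0 ?ltW.
  + by move=> x; rewrite mulrDl -rnormZ (le_trans (rnormB _ _))// lerD2l.
- by rewrite divr_gt0// subr_gt0.
- move=> x; rewrite mulrAC ler_pdivrMr// [leRHS]mulrC.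
  exact: power_bounded_below.
move=> y e e0.
(* The witnesses are the partial sums of the Neumann series, which leave the
   residue [l ^- n *: T ^ n y]. *)
have step n : exists x, l *: x - T x - y = - (l^-1 ^+ n *: iter n T y).
  elim: n => [|n [x xE]].
    by exists 0; rewrite scaler0 fE linear0 subr0 sub0r expr0 scale1r.
  exists (l^-1 *: (y + T x)).
  rewrite exprS -scalerA iterS -[in RHS]scalerN.
  have -> : - (l^-1 ^+ n *: T (iter n T y)) = T (l *: x - T x - y).
    by rewrite xE fE [f (- _)]linearN [f (_ *: _)]linearZ.
  rewrite scalerA divff// scale1r fE [f (_ *: _)]linearZ/=.
  rewrite [f (_ - y)]linearB [f (_ - _)]linearB [f (_ + _)]linearD.
  rewrite [f (_ *: x)]linearZ/=.
  rewrite !scalerBr scalerDr scalerA mulVf// scale1r.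
  by rewrite addrAC [y + _]addrC addrK opprD addrA addrAC.
have [k ke] : exists k, (rnorm l)^-1 ^+ k * (M * rnorm y) <= e.
  have cv : (rnorm l)^-1 ^+ k * (M * rnorm y) @[k --> \oo] --> (0 : R).
    rewrite -(mul0r (M * rnorm y)); apply: cvgM; last exact: cvg_cst.
    apply: cvg_expr; rewrite ger0_norm ?invr_ge0 ?rnorm_ge0//.
    by rewrite invf_lt1// (lt_trans ltr01).
  have /cvgr0Pnorm_le/(_ _ e0) [k _ kP] := cv.
  by exists k; rewrite (le_trans (ler_norm _))//; exact: (kP k (leqnn k)).
have [x xE] := step k; exists x; rewrite xE rnormN rnormZ rnormX rnormV.
by apply: le_trans ke; rewrite ler_wpM2l// exprn_ge0// invr_ge0 rnorm_ge0.
Qed.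

(** Together with [lower_bound_of_ritt], this replaces the operator norm of the
    resolvent by an inequality between vectors. *)
Lemma ritt_of_lower_bound (C : R) : 0 <= C ->
  (forall l x, 1 < rnorm l ->
     rnorm (l - 1) * rnorm x <= C * rnorm (l *: x - T x)) ->
  ritt T.
Proof.
move=> C0 lowT; split=> [l sl /=|].
  rewrite leNgt; apply/negP => l1; apply: sl; exact: power_bounded_inverse.
apply: le_lt_trans (ltry C); apply: ge_ereal_sup => _ [l /= l1 <-].
have l10 : 0 < rnorm (l - 1).
  by rewrite rnorm_gt0 subr_eq0; apply: contraTneq l1 => ->; rewrite rnorm1 ltxx.
have [_ _ SK] : inverse_op (fun x => l *: x - T x) (resolvent T l).
  by apply: resolventP => /(_ (power_bounded_inverse l1)).
have Sb : (opnorm (resolvent T l) <= (C / rnorm (l - 1))%:E)%E.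
  apply: opnorm_le => [|x]; first by rewrite divr_ge0 ?rnorm_ge0.
  rewrite mulrAC ler_pdivlMr// mulrC -{2}[x]SK.
  exact: lowT.
apply: le_trans (lee_wpmul2l _ Sb) _; first by rewrite lee_fin rnorm_ge0.
by rewrite -EFinM lee_fin mulrC divfK// gt_eqF.
Qed.

End power_bounded_resolvent.

Lemma lower_bound_of_ritt (R : realType) (X : normedModType R[i]) (T : X -> X) :
  ritt T -> exists2 C : R, 0 <= C & forall (l : R[i]) (x : X), 1 < rnorm l ->
    rnorm (l - 1) * rnorm x <= C * rnorm (l *: x - T x).
Proof.
move=> [specT]; set s := ereal_sup _ => soo.
have term l : 1 < rnorm l ->
    [/\ (0 <= opnorm (resolvent T l))%E,
        ((rnorm (l - 1))%:E * opnorm (resolvent T l) <= s)%E &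
        inverse_op (fun x => l *: x - T x) (resolvent T l)].
  move=> l1; have inv : inverse_op (fun x => l *: x - T x) (resolvent T l).
    by apply: resolventP => /specT /=; rewrite leNgt l1.
  have [[lS _] _ _] := inv; split=> //; first exact: opnorm_ge0.
  by apply: ereal_sup_ubound; exists l.
have s0 : (0 <= s)%E.
  have l1 : 1 < rnorm (2 : R)%:C.
    by rewrite rnorm_real ger0_norm ?ltr1n.
  have [S0 Ss _] := term _ l1.
  by apply: le_trans Ss; rewrite mule_ge0// lee_fin rnorm_ge0.
have sfin : s \is a fin_num by rewrite ge0_fin_numE.
exists (fine s) => [|l x l1]; first exact: fine_ge0.
have [S0 Ss [[lS Soo] SK _]] := term _ l1.
have Sfin : opnorm (resolvent T l) \is a fin_num by rewrite ge0_fin_numE.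
rewrite -{1}[x]SK; set y := l *: x - T x.
have Sy : rnorm (resolvent T l y) <= fine (opnorm (resolvent T l)) * rnorm y.
  by apply: opnorm_bound => //; rewrite fineK.
apply: le_trans (ler_wpM2l (rnorm_ge0 _) Sy) _.
rewrite mulrA ler_wpM2r ?rnorm_ge0// -lee_fin EFinM !fineK//.
Qed.

(** * From escaping arguments to the Ritt condition *)

(** A point outside the disc that approaches 1 tangentially is, up to an error
    that is small relative to its distance to 1, the unimodular number whose
    argument is its imaginary part. *)
Lemma expi_Im_near_one (R : realType) (l : R[i]) (tau d : R) :
  1 < rnorm l -> rnorm (l - 1) <= d -> d <= 4^-1 -> tau <= 4^-1 ->
  rnorm l - 1 <= tau * rnorm (l - 1) ->
  rnorm (l - expi (complex.Im l)) <= (tau + 3 * d) * rnorm (l - 1) /\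
  rnorm (l - 1) <= 2 * `|complex.Im l|.
Proof.
case: l => a b; set l := a +i* b; set u := rnorm (l - 1) => l1 ud d4 tau4 tang.
have u0 : 0 <= u := rnorm_ge0 _.
have lE := rnormC2 l.
have Re1 := ler_Re_rnorm (l - 1); have Im1 := ler_Im_rnorm (l - 1).
have ul := rnormE_Re_Im (l - 1).
have dist := rnormE_Re_Im (l - expi (complex.Im l)).
have Rel := le_trans (ler_norm _) (ler_Re_rnorm l).
rewrite -/u in Re1 Im1 ul.
rewrite /= subr0 in Re1 Im1 ul dist lE Rel *.
have b2 : b ^+ 2 <= d * u.
  by rewrite -real_normK ?num_real// expr2 ler_pM// (le_trans Im1).
have b2' : b ^+ 2 <= d * `|b|.
  by rewrite -real_normK ?num_real// expr2 ler_wpM2r// (le_trans Im1).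
have a34 : 3 / 4 <= a by move: Re1; rewrite ler_norml => /andP[]; lra.
have l2 : 1 < a ^+ 2 + b ^+ 2 by rewrite -lE exprn_egt1.
have a1 : `|a - 1| <= tau * u + b ^+ 2.
  rewrite ler_norml; apply/andP; split; last by have := sqr_ge0 b; lra.
  have : 0 <= tau * u by apply: le_trans tang; rewrite subr_ge0 ltW.
  nra.
have cosb : `|a - cos b| <= tau * u + b ^+ 2 + b ^+ 2 / 2.
  apply: (le_trans (ler_distD 1 _ _)); rewrite lerD// ger0_norm.
    by have := cos_ge b; lra.
  by rewrite subr_ge0 (le_trans (ler_norm _))// cos_max.
have sinb : `|b - sin b| <= b ^+ 2 by apply: ler_norm_subr_sin; lra.
split; first by have := sqr_ge0 b; lra.
have : tau * u <= 4^-1 * u by rewrite ler_wpM2r.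
have : d * `|b| <= 4^-1 * `|b| by rewrite ler_wpM2r.
lra.
Qed.

Section criterion.
Variables (R : realType) (X : completeNormedModType R[i]).
Variables (T : X -> X) (M q : R) (N : set nat).
Hypothesis (lT : linear T) (M_gt0 : 0 < M).
Hypothesis TM : forall n x, rnorm (iter n T x) <= M * rnorm x.
Hypothesis TN : forall n x, N n -> rnorm (x - iter n T x) <= q * rnorm x.
Implicit Types (l : R[i]) (x y : X).

(** Since [|l| - 1] is controlled by the resolvent, failure of the estimate at
    [l] forces [l] to be tangential, and makes [x] an approximate eigenvector
    for [expi t] with [t = Im l], with an error that is small relative to
    [|t|].  For [n * |t| <= B] the vector [T ^ n x] is then close to
    [expi (n * t) *: x], which for a suitable [n] in [N] is further than [q]
    from [x]. *)
Lemma lower_bound_near_one (B c t0 : R) : q < c -> 0 < t0 ->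
  (forall t, 0 < t < t0 -> exists n, [/\ N n, n%:R * t <= B &
     c < rnorm (1 - expi (n%:R * t))]) ->
  exists e d : R, [/\ 0 < e, 0 < d &
    forall l x, 1 < rnorm l -> rnorm (l - 1) < d ->
      e * rnorm (l - 1) * rnorm x <= rnorm (l *: x - T x)].
Proof.
move=> qc t0_gt0 esc.
pose eta := Num.min 1 ((c - q) / (M * (`|B| + 1))).
have MB0 : 0 < M * (`|B| + 1) by rewrite mulr_gt0// ltr_wpDl.
have eta0 : 0 < eta by rewrite lt_min ltr01 divr_gt0// subr_gt0.
have eta1 : eta <= 1 by rewrite ge_min lexx.
have etaB : q + M * (`|B| + 1) * eta <= c.
  by rewrite addrC -lerBrDr mulrC -ler_pdivlMr// ge_min lexx orbT.
(* The two errors [(1 + M) * e] and [3 * d] of the approximate eigenvalue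
   must add up to at most [eta / 2], as [|l - 1|] is at most [2 * |Im l|]. *)
pose e := eta / (4 * (1 + M)).
have e0 : 0 < e by rewrite divr_gt0// mulr_gt0// addr_gt0.
have eE : (1 + M) * e = eta / 4.
  by rewrite /e; field; rewrite gt_eqF// addr_gt0.
pose d := Num.min (eta / 12) t0.
have d0 : 0 < d by rewrite lt_min t0_gt0 andbT divr_gt0.
have deta : d <= eta / 12 by rewrite ge_min lexx.
have dt0 : d <= t0 by rewrite ge_min lexx orbT.
exists e, d; split=> // l x l1 ld; rewrite leNgt; apply/negP.
set u := rnorm (l - 1) in ld *; set D := rnorm _ => Dx.
have nx0 : 0 < rnorm x.
  rewrite rnorm_gt0; apply: contraTneq Dx => ->.
  by rewrite rnorm0 mulr0 -leNgt rnorm_ge0.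
have tang : rnorm l - 1 <= M * e * u.
  rewrite -(ler_pM2r nx0) (le_trans (power_bounded_below lT M_gt0 TM x l1))//.
  have -> : M * e * u * rnorm x = M * (e * u * rnorm x) by ring.
  by rewrite ler_pM2l// ltW.
have [||le_expi u2] := expi_Im_near_one l1 (ltW ld) _ _ tang; [lra|nra|].
set b := complex.Im l in le_expi u2.
have u0 : 0 < u.
  by rewrite rnorm_gt0 subr_eq0; apply: contraTneq l1 => ->; rewrite rnorm1 ltxx.
have b0 : 0 < `|b| by lra.
have bu : `|b| <= u.
  have := ler_Im_rnorm (l - 1); rewrite -/u /b; by case: (l) => ? ? /=; rewrite subr0.
have [|n [Nn nB nc]] := esc `|b|; first by lra.
have approx : rnorm (expi b *: x - T x) <= eta * `|b| * rnorm x.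
  apply: (le_trans (rnorm_triangle _ (l *: x) _)).
  rewrite -scalerBl rnormZ (rnormB_sym (expi b)).
  apply: (@le_trans _ _ ((M * e + 3 * d) * u * rnorm x + e * u * rnorm x)).
    by apply: lerD; [exact: ler_wpM2r (ltW nx0) _ _ le_expi|exact: ltW].
  rewrite -mulrDl ler_pM2r//.
  have -> : (M * e + 3 * d) * u + e * u = ((1 + M) * e + 3 * d) * u by ring.
  rewrite eE; nra.
have := iter_approx_eigen lT M_gt0 TM (expi b) x n.
rewrite rnorm_expi (eq_bigr (fun=> 1)) => [|k _]; last by rewrite expr1n.
rewrite sumr_const card_ord expiX => itern.
have itern' : rnorm (iter n T x - expi (n%:R * b) *: x) <=
    M * (`|B| + 1) * eta * rnorm x.
  apply: le_trans itern _.
  apply: (@le_trans _ _ (M * (eta * `|b| * rnorm x) * n%:R)).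
    by rewrite ler_wpM2r ?ler0n// ler_wpM2l// ltW.
  have -> : M * (eta * `|b| * rnorm x) * n%:R =
      M * (n%:R * `|b|) * (eta * rnorm x) by ring.
  rewrite -[leRHS]mulrA ler_wpM2r ?mulr_ge0 ?(ltW eta0) ?(ltW nx0)//.
  by rewrite ler_pM2l// (le_trans nB)// (le_trans (ler_norm B))// lerDl.
have : c * rnorm x < (q + M * (`|B| + 1) * eta) * rnorm x.
  rewrite mulrDl; apply: lt_le_trans (lerD (TN x Nn) itern').
  apply: lt_le_trans (rnormD _ _).
  rewrite subrKA -[x in x - _]scale1r -scalerBl rnormZ ltr_pM2r//.
  by rewrite -rnorm_1Bexpi_norm normrM ger0_norm ?ler0n.
by rewrite ltr_pM2r// ltNge etaB.
Qed.

(** Away from 1 the lower bound persists near every point at which [l - T]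
    is invertible, so it holds uniformly on compact sets; outside the disc of
    radius 2 it follows from power boundedness alone. *)
Lemma ritt_of_escape (B c t0 : R) : q < c -> 0 < t0 ->
  (forall t, 0 < t < t0 -> exists n, [/\ N n, n%:R * t <= B &
     c < rnorm (1 - expi (n%:R * t))]) ->
  spectrum T `&` [set l | rnorm l = 1] `<=` [set 1] ->
  ritt T.
Proof.
move=> qc t0_gt0 esc specT.
pose low (e : R) l := 1 < rnorm l -> forall x,
  e * rnorm (l - 1) * rnorm x <= rnorm (l *: x - T x).
have local l0 : exists e d : R, [/\ 0 < e, 0 < d &
    forall l, rnorm (l - l0) < d -> low e l].
  have [->|l01] := eqVneq l0 1.
    have [e [d [e0 d0 ed]]] := lower_bound_near_one qc t0_gt0 esc.
    by exists e, d; split=> // l ll0 l1 x; exact: ed.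
  have [l0lt|l0ge] := ltP (rnorm l0) 1.
    exists 1, (1 - rnorm l0); split=> [//||l ll0 l1]; first by rewrite subr_gt0.
    have := lerB_rnorm l l0; lra.
  have [S [bS SK _]] : exists S, inverse_op (fun x => l0 *: x - T x) S.
    move: l0ge; rewrite le_eqVlt => /predU1P[l0E|]; last first.
      exact: power_bounded_inverse lT M_gt0 TM _.
    have := contra_not (specT l0) (elimN eqP l01).
    by move=> /not_andP[/contrapT//|]; rewrite /= -l0E.
  have [C C0 SC] := bounded_op_bound bS.
  have dC : 0 < (2 * C)^-1 by rewrite invr_gt0 mulr_gt0.
  (* On the ball of radius [1 / (2 * C)] the lower bound [1 / C] at [l0] loses
     at most half of its value, and [K] bounds [|l - 1|]. *)
  pose K := rnorm l0 + (2 * C)^-1 + 1.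
  have K0 : 0 < K by rewrite ltr_wpDl// addr_ge0 ?rnorm_ge0// ltW.
  exists ((2 * C)^-1 / K), (2 * C)^-1; split=> [||l ll0 l1 x];
    [exact: divr_gt0|exact: dC|].
  have xS : rnorm x <= C * rnorm (l0 *: x - T x) by rewrite -{1}[x]SK; exact: SC.
  have tri : rnorm (l0 *: x - T x) <=
      (2 * C)^-1 * rnorm x + rnorm (l *: x - T x).
    apply: (le_trans (rnorm_triangle _ (l *: x) _)).
    rewrite lerD2r -scalerBl rnormZ rnormB_sym ler_wpM2r ?rnorm_ge0//.
    exact: ltW.
  have half : (2 * C)^-1 * rnorm x <= rnorm (l *: x - T x).
    have : C^-1 * rnorm x <= rnorm (l0 *: x - T x).
      by rewrite mulrC ler_pdivrMr// mulrC.
    have -> : C^-1 = (2 * C)^-1 + (2 * C)^-1 by field; rewrite gt_eqF.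
    by lra.
  apply: le_trans half; rewrite ler_wpM2r ?rnorm_ge0// -mulrA ger_pMr//.
  rewrite mulrC ler_pdivrMr// mul1r (le_trans (rnormB _ _))// rnorm1 lerD2r.
  have := lerB_rnorm l l0; lra.
have [e e0 elow] : exists2 e : R, 0 < e & forall l, rnorm l <= 2 -> low e l.
  (* The square contains the disc of radius 2; inside the unit disc [low] is
     void. *)
  pose sq := (`[-2, 2]%classic : set R) `*` (`[-2, 2]%classic : set R).
  have csq : compact sq by apply: compact_setX; exact: segment_compact.
  have nsq : near_covering sq by apply/compact_near_coveringP.
  have [|d /= d0 dP] := nsq R 0^'+ (fun e z => low e (z.1 +i* z.2)) _.
    move=> [a b] _.
    have [e [d [e0 d0 ed]]] := local (a +i* b).
    exists (ball (a, b) (d / 2), [set e' | 0 < e' < e]) => /=.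
      split; first by apply: nbhsx_ballx; rewrite divr_gt0.
      exists e => //= e' /=; rewrite sub0r normrN => e'e e'0.
      by rewrite e'0/= (le_lt_trans (ler_norm _)).
    move=> [[a' b'] e'] /= [[/= aa bb] /andP[e'0 e'e]] l1 x.
    apply: le_trans (ed (a' +i* b') _ l1 x).
      by rewrite ler_wpM2r ?rnorm_ge0// ler_wpM2r ?rnorm_ge0// ltW.
    apply: le_lt_trans (rnormE_Re_Im _) _ => /=.
    by rewrite [d]splitr ltrD// distrC.
  exists (d / 2); first by rewrite divr_gt0.
  move=> l l2; have := dP (d / 2) _ _ (complex.Re l, complex.Im l).
  case: l l2 => a b l2 /=; apply.
  - by rewrite sub0r normrN gtr0_norm ?divr_gt0// ltr_pdivrMr// ltr_pMr// ltr1n.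
  - by rewrite divr_gt0.
  - have := ler_Re_rnorm (a +i* b); have := ler_Im_rnorm (a +i* b) => /= Hb Ha.
    by split; rewrite /= in_itv/= -ler_norml; [apply: le_trans Ha _|apply: le_trans Hb _].
apply: (ritt_of_lower_bound lT M_gt0 TM (C := e^-1 + 3 * M)) => [|l x l1].
  by rewrite addr_ge0 ?invr_ge0 ?mulr_ge0 ?(ltW e0)// ltW.
have D0 := rnorm_ge0 (l *: x - T x).
rewrite mulrDl; have [l2|l2] := leP (rnorm l) 2.
  rewrite ler_wpDr ?mulr_ge0 ?(ltW M_gt0)//.
  by rewrite [leRHS]mulrC ler_pdivlMr// mulrC mulrA elow.
rewrite ler_wpDl ?mulr_ge0 ?invr_ge0 ?(ltW e0)//.
have := power_bounded_below lT M_gt0 TM x l1.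
have : rnorm (l - 1) <= 3 * (rnorm l - 1).
  by rewrite (le_trans (rnormB _ _))// rnorm1; lra.
have := rnorm_ge0 x; nra.
Qed.

End criterion.

(** * The quantity alpha *)

Section alpha.
Variables (R : realType) (N : set nat).
Implicit Types (B c d e q t : R) (n : nat).

Lemma finite_hN_index B t : 0 < t ->
  finite_set [set n | N n /\ n%:R * t <= B].
Proof.
move=> t0; apply: (sub_finite_set (B := `I_((Num.truncn (B / t)).+1))).
  move=> n /= [_ ntB]; rewrite -(ltr_nat R).
  by apply: le_lt_trans (truncnS_gt _); rewrite ler_pdivlMr.
exact: finite_II.
Qed.

Lemma hN_ge B t n : 0 < t -> N n -> n%:R * t <= B ->
  rnorm (1 - expi (n%:R * t)) <= hN N B t.
Proof.
move=> t0 Nn ntB.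
apply: (@le_bigmax_seq _ _ _ _ _ n xpredT
  (fun k => rnorm (1 - expi (k%:R * t)))) => //.
by rewrite in_fset_set ?inE//; exact: finite_hN_index.
Qed.

Lemma hN_le B t c : 0 < t -> 0 <= c ->
  (forall n, N n -> n%:R * t <= B -> rnorm (1 - expi (n%:R * t)) <= c) ->
  hN N B t <= c.
Proof.
move=> t0 c0 Nc; rewrite /hN big_seq; apply: bigmax_le => // n.
rewrite in_fset_set ?inE => [[Nn]|]; first exact: Nc.
exact: finite_hN_index.
Qed.

Lemma hN_ge0 B t : 0 <= hN N B t.
Proof. exact: bigmax_ge_id. Qed.

Lemma hN_nondecreasing B B' t : 0 < t -> B <= B' -> hN N B t <= hN N B' t.
Proof.
move=> t0 BB'; apply: hN_le => // [|n Nn ntB]; first exact: hN_ge0.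
by apply: hN_ge => //; exact: le_trans BB'.
Qed.

Let liminf B : \bar R := limf_einf (fun t : R => (hN N B t)%:E) 0^'+.

(* Only positive [t] matter for the lower limit, and there [hN] is monotone. *)
Let liminf_nondecreasing B B' : B <= B' -> (liminf B <= liminf B')%E.
Proof.
move=> BB'; rewrite /liminf !limf_einfE.
apply: ge_ereal_sup => _ [V V0 <-].
apply: (@le_trans _ _ (ereal_inf
  [set (hN N B' t)%:E | t in V `&` [set t | 0 < t]])); last first.
  apply: ereal_sup_ubound; exists (V `&` [set t | 0 < t]) => //.
  by apply: filterI => //; exact: nbhs_right_gt.
apply: le_ereal_inf_tmp => _ [t [Vt /= t0] <-].
apply: le_trans (_ : ((hN N B t)%:E <= _)%E).
  by apply: ereal_inf_lbound; exists t.
by rewrite lee_fin hN_nondecreasing.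
Qed.

Let alphaE : alpha R N = ereal_sup (range liminf).
Proof.
by apply/cvg_lim => //; apply: nondecreasing_cvge => B B'; exact: liminf_nondecreasing.
Qed.

(** Being monotone in [B], the lower limits exceed [q] from some [B] on; the
    bound [c] leaves room between [q] and the values of [hN]. *)
Lemma alpha_gt q : 0 <= q -> (q%:E < alpha R N)%E ->
  exists B c t0, [/\ q < c, 0 < t0 &
    forall t, 0 < t < t0 -> exists n, [/\ N n, n%:R * t <= B &
     c < rnorm (1 - expi (n%:R * t))]].
Proof.
move=> q0; rewrite alphaE => /ereal_sup_gt[_ [B _ <-]].
rewrite /liminf limf_einfE => /ereal_sup_gt[_ [V V0 <-]] qV.
have [c qc cV] : exists2 c, q < c &
    (c%:E < ereal_inf [set (hN N B t)%:E | t in V])%E.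
  case: ereal_inf qV => [r||//]; rewrite ?lte_fin => qr.
    by exists ((q + r) / 2); rewrite ?lte_fin (midf_lt qr).
  by exists (q + 1); rewrite ?ltry// ltrDl.
move: V0 => [t0 /= t0_gt0 t0V]; exists B, c, t0; split=> // t /andP[t_gt0 tt0].
have Vt : V t by apply: t0V => //=; rewrite sub0r normrN gtr0_norm.
have : c < hN N B t.
  rewrite -lte_fin; apply: lt_le_trans cV _.
  by apply: ereal_inf_lbound; exists t.
apply: contraPP => /forallNP noesc; apply/negP; rewrite -leNgt.
apply: hN_le => // [|n Nn ntB]; first by rewrite (le_trans q0)// ltW.
by rewrite leNgt; apply/negP => cn; apply: (noesc n).
Qed.

(** No lower limit exceeds the limit [alpha R N], so [hN] comes arbitrarily
    close to [q] for arbitrarily small [t]. *)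
Lemma alpha_le q B e d : ~ (q%:E < alpha R N)%E -> 0 < e -> 0 < d ->
  exists2 t, 0 < t < d & hN N B t < q + e.
Proof.
move=> nq e0 d0; apply: contrapT => /forall2NP noT; apply: nq.
rewrite alphaE; apply: lt_le_trans (_ : (liminf B <= _)%E); last first.
  by apply: ereal_sup_ubound; exists B.
rewrite /liminf limf_einfE.
apply: (@lt_le_trans _ _ (q + e)%:E); first by rewrite lte_fin ltrDl.
apply: (@le_trans _ _ (ereal_inf [set (hN N B t)%:E | t in [set t | 0 < t < d]])).
  apply: le_ereal_inf_tmp => _ [t /= td <-]; rewrite lee_fin leNgt.
  by apply/negP => h; case: (noT t).
apply: ereal_sup_ubound; exists [set t | 0 < t < d] => //.
exists d => //= t /=; rewrite sub0r normrN => td t0.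
by rewrite t0 (le_lt_trans (ler_norm _)).
Qed.

End alpha.

(** * Diagonal operators on the space of square-summable sequences *)

Section diagonal.
Variable R : realType.
Implicit Types (x y : ell2 R) (w : nat -> R[i]) (c : R).

Lemma rnorm_ell2 x : rnorm x = ell2_norm x.
Proof. by []. Qed.

Lemma ell2P x y : (forall n, x n = y n) -> x = y.
Proof. by move=> xy; apply/val_inj/funext. Qed.

Lemma sqnorm_dominated (u : nat -> R[i]) x c :
  (forall n, rnorm (u n) <= c * rnorm (x n)) ->
  (sqnorm u <= ((c * rnorm x) ^+ 2)%:E)%E.
Proof.
move=> ux; apply: sqnorm_le => k; rewrite exprMn.
have := sqnorm_partial x k; rewrite -ell2_normK lee_fin -rnorm_ell2 => xk.
apply: le_trans (ler_wpM2l (sqr_ge0 c) xk); rewrite mulr_sumr.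
apply: ler_sum => n _; rewrite -exprMn.
have ux_n := ux n; have u0 := rnorm_ge0 (u n).
by rewrite lerXn2r ?nnegrE// (le_trans u0).
Qed.

Lemma ell2_norm_dominated x y c : 0 <= c ->
  (forall n, rnorm (y n) <= c * rnorm (x n)) -> rnorm y <= c * rnorm x.
Proof.
move=> c0 yx; rewrite -(@ler_pXn2r _ 2) ?nnegrE ?mulr_ge0 ?rnorm_ge0//.
by rewrite -lee_fin rnorm_ell2 ell2_normK; exact: sqnorm_dominated.
Qed.

(** The default value 0 is never taken when [w] is bounded, since then the
    product is square-summable ([diag_opE]). *)
Definition diag_op w x : ell2 R := insubd 0 (fun n => w n * x n).

Lemma diag_opE w c x n : (forall k, rnorm (w k) <= c) ->
  diag_op w x n = w n * x n.
Proof.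
move=> wc; rewrite /diag_op insubdK//.
suff : (sqnorm (fun k => w k * x k)%R <= ((c * rnorm x) ^+ 2)%:E)%E.
  by move=> h; rewrite inE; exact: le_lt_trans h (ltry _).
by apply: sqnorm_dominated => k; rewrite rnormM ler_wpM2r ?rnorm_ge0.
Qed.

Lemma diag_op_linear w c : (forall k, rnorm (w k) <= c) -> linear (diag_op w).
Proof.
move=> wc a x y; apply: ell2P => n.
rewrite -[RHS]/(a * diag_op w x n + diag_op w y n) !(diag_opE _ _ wc).
by rewrite -[(a *: x + y) n]/(a * x n + y n) mulrDr mulrCA.
Qed.

Lemma diag_op_le w c x : 0 <= c -> (forall k, rnorm (w k) <= c) ->
  rnorm (diag_op w x) <= c * rnorm x.
Proof.
move=> c0 wc; apply: ell2_norm_dominated => // n.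
by rewrite (diag_opE _ _ wc) rnormM ler_wpM2r ?rnorm_ge0.
Qed.

Lemma diag_op_bounded w c : (forall k, rnorm (w k) <= c) ->
  bounded_op (diag_op w).
Proof.
move=> wc; have c0 : 0 <= c := le_trans (rnorm_ge0 _) (wc 0%N).
apply: (bounded_op_intro (diag_op_linear wc) c0) => x; exact: diag_op_le.
Qed.

Lemma diag_op_normal w c : (forall k, rnorm (w k) <= c) ->
  normal_op (diag_op w).
Proof.
move=> wc; pose w' n := (w n)^*.
have w'c k : rnorm (w' k) <= c by rewrite rnorm_conj.
exists (diag_op w'); split; first exact: diag_op_bounded w'c.
  move=> x y; rewrite /ell2_dot; congr (limn (series _)); apply/funext => n.
  rewrite (diag_opE _ _ wc) (diag_opE _ _ w'c) [in RHS]rmorphM /= /w' conjCK.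
  by rewrite mulrCA mulrA.
apply/funext => x; apply: ell2P => n /=.
by rewrite !((diag_opE _ _ wc), (diag_opE _ _ w'c)) mulrCA.
Qed.

Lemma iter_diag_op w c n x k : (forall k, rnorm (w k) <= c) ->
  iter n (diag_op w) x k = w k ^+ n * x k.
Proof.
move=> wc; elim: n => [|n IHn]; first by rewrite expr0 mul1r.
by rewrite iterS (diag_opE _ _ wc) IHn exprS mulrA.
Qed.

Lemma diag_op_spectrum w c l a : (forall k, rnorm (w k) <= c) -> 0 < a ->
  (forall k, a <= rnorm (l - w k)) -> ~ spectrum (diag_op w) l.
Proof.
move=> wc a0 lw; apply; pose v k := (l - w k)^-1.
have vc k : rnorm (v k) <= a^-1.
  by rewrite rnormV lef_pV2 ?posrE// (lt_le_trans a0).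
have lw0 k : l - w k != 0 by rewrite -rnorm_gt0 (lt_le_trans a0).
exists (diag_op v); split; first exact: diag_op_bounded vc.
  move=> x; apply: ell2P => n; rewrite (diag_opE _ _ vc).
  rewrite -[(l *: x - _) n]/(l * x n - diag_op w x n) (diag_opE _ _ wc).
  by rewrite -mulrBl mulrA mulVf// mul1r.
move=> x; apply: ell2P => n.
rewrite -[LHS]/(l * diag_op v x n - diag_op w (diag_op v x) n).
by rewrite (diag_opE _ _ wc) (diag_opE _ _ vc) -mulrBl mulrA divff// mul1r.
Qed.

Lemma diag_op_eigenvector w c k : (forall k, rnorm (w k) <= c) ->
  exists2 x, 0 < rnorm x & diag_op w x = w k *: x.
Proof.
move=> wc; pose u n : R[i] := (n == k)%:R.
have ul : u \in @ell2_pred R.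
  rewrite inE; apply: le_lt_trans (ltry 1); apply: sqnorm_le => K.
  rewrite (eq_bigr (fun n => (n == k)%:R)) => [|n _]; last first.
    by rewrite /u; case: eqP => _; rewrite ?rnorm1 ?rnorm0 ?expr1n ?expr0n.
  rewrite -natr_sum big_mkord -[1]/(1%:R) ler_nat.
  have [kK|Kk] := ltnP k K.
    rewrite (bigD1 (Ordinal kK))//= eqxx big1 ?addn0// => i ik.
    by apply/eqP; rewrite eqb0; apply: contraNneq ik => ik; apply/eqP/val_inj.
  by rewrite big1// => i _; rewrite ltn_eqF// (leq_trans (ltn_ord i)).
exists (Ell2 ul).
  rewrite rnorm_gt0; apply/eqP => /(congr1 (fun x : ell2 R => x k)) /=.
  by rewrite /u eqxx => /eqP; rewrite oner_eq0.
apply: ell2P => n; rewrite (diag_opE _ _ wc) /= /u -[RHS]/(w k * (n == k)%:R).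
by case: eqP => [->//|_]; rewrite !mulr0.
Qed.

End diagonal.

(** * A diagonal operator that is not Ritt *)

Section counterexample.
Variable R : realType.
Implicit Types (s t q : R).

(** As [t] tends to 0 this point tends to 1, and its distance to the circle is
    equivalent to [s * t]: a small [s] means a nearly tangential approach. *)
Definition spiral s t : R[i] := ((1 + s * t)^-1)%:C * expi t.

Section spiral.
Variables s t : R.
Hypotheses (s0 : 0 < s) (t0 : 0 < t).

Let st0 : 0 < s * t. Proof. exact: mulr_gt0. Qed.
Let r0 : 0 < 1 + s * t. Proof. exact: addr_gt0. Qed.

Lemma rnorm_spiral : rnorm (spiral s t) = (1 + s * t)^-1.
Proof.
by rewrite rnormM rnorm_expi mulr1 rnorm_real ger0_norm// invr_ge0 ltW.
Qed.

Lemma rnorm_spiral_lt1 : rnorm (spiral s t) < 1.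
Proof. by rewrite rnorm_spiral invf_lt1// ltrDl. Qed.

Lemma rnorm_1Bspiral : rnorm (1 - spiral s t) <= t + s * t.
Proof.
apply: le_trans (rnorm_triangle _ (expi t) _) _; rewrite lerD//.
  by rewrite (le_trans (rnorm_1Bexpi_le t))// gtr0_norm.
rewrite /spiral -{1}[expi t]mul1r -mulrBl rnormM rnorm_expi mulr1.
rewrite -[1]/(1%:C) -rmorphB rnorm_real ger0_norm.
  have : 0 < (1 + s * t)^-1 by rewrite invr_gt0.
  by have := mulVf (lt0r_neq0 r0); have := st0; nra.
by rewrite subr_ge0 invf_le1// lerDl ltW.
Qed.

(** By Bernoulli's inequality, the modulus [r] of the [n]-th power is at most
    [1 / (1 + s * (n * t))].  Put [B = 1 / (s * (q - 1))].  For [n * t <= 1]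
    the argument [n * t] alone keeps the power within 1 of 1; for
    [1 < n * t <= B] the convex combination
    [1 - r + r * (q + s * (q - 1))] is at most [q] because
    [r * (1 + s) <= 1]; for [n * t > B] the modulus is at most [q - 1]. *)
Lemma spiral_powers_near1 q (N : set nat) : 1 < q ->
  hN N (s * (q - 1))^-1 t < q + s * (q - 1) ->
  forall n, N n -> rnorm (1 - spiral s t ^+ n) <= q.
Proof.
move=> q1 hq n Nn; have q10 : 0 < q - 1 by rewrite subr_gt0.
pose r := (1 + s * t)^-1 ^+ n; pose th := n%:R * t.
have r_gt0 : 0 < r by rewrite exprn_gt0// invr_gt0.
have th0 : 0 <= th by rewrite mulr_ge0 ?ler0n// ltW.
have r_le : r * (1 + s * th) <= 1.
  rewrite /r exprVn mulrC ler_pdivrMr ?exprn_gt0// mul1r /th.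
  elim: (n) => [|m IHm]; first by rewrite mul0r mulr0 addr0 expr0.
  rewrite exprS -natr1; move: IHm; have : 0 <= m%:R :> R by exact: ler0n.
  set z := _ ^+ m; set m' := m%:R => m'0 IHm.
  have : 0 <= m' * (s * t) * (s * t) by rewrite !mulr_ge0 ?(ltW s0) ?(ltW t0).
  by have := ler_wpM2l (ltW r0) IHm; lra.
have r1 : r <= 1.
  apply: le_trans r_le; rewrite ler_peMr ?(ltW r_gt0)// lerDl.
  by rewrite mulr_ge0// ltW.
have -> : spiral s t ^+ n = r%:C * expi th by rewrite exprMn -rmorphXn expiX.
have conv : rnorm (1 - r%:C * expi th) <= 1 - r + r * rnorm (1 - expi th).
  have -> : 1 - r%:C * expi th = (1 - r)%:C + r%:C * (1 - expi th).
    by rewrite rmorphB/= mulrBr mulr1 subrKA.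
  apply: le_trans (rnormD _ _) _.
  by rewrite rnormM !rnorm_real !ger0_norm ?(ltW r_gt0)// subr_ge0.
have [th1|th1] := leP th 1.
  have := rnorm_1Bexpi_le th; rewrite ger0_norm// => e1.
  by nra.
have [thB|thB] := leP th (s * (q - 1))^-1.
  have e1 : rnorm (1 - expi th) <= q + s * (q - 1).
    exact: ltW (le_lt_trans (hN_ge t0 Nn thB) hq).
  have rs : r * (1 + s) <= 1.
    by apply: le_trans r_le; rewrite ler_pM2l// lerD2l ler_peMr ?(ltW s0) ?(ltW th1).
  have : r * rnorm (1 - expi th) <= r * (q + s * (q - 1)) by rewrite ler_pM2l.
  have : (r * (1 + s)) * (q - 1) <= 1 * (q - 1) by rewrite ler_pM2r.
  by lra.
have rq : r <= q - 1.
  have sth : 1 < s * th * (q - 1).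
    have a0 : 0 < s * (q - 1) by exact: mulr_gt0.
    by rewrite mulrAC -[ltLHS](mulfV (lt0r_neq0 a0)) ltr_pM2l.
  have : r * (s * th * (q - 1)) <= q - 1 by nra.
  have : r <= r * (s * th * (q - 1)) by rewrite ler_peMr ?(ltW r_gt0)// ltW.
  lra.
apply: le_trans (rnormB _ _) _.
rewrite rnorm1 rnormM rnorm_expi mulr1 rnorm_real ger0_norm ?(ltW r_gt0)//.
by lra.
Qed.

(** The point [(1 + s * t) * expi t], the reflection of [spiral s t] in the
    circle, is at distance at most [2 * s * t] from [spiral s t] but at
    distance at least [t / 2] from 1. *)
Lemma spiral_not_ritt (C : R) : t <= 1 -> 0 <= C ->
  (forall l : R[i], 1 < rnorm l -> rnorm (l - 1) <= C * rnorm (l - spiral s t)) ->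
  1 <= 4 * C * s.
Proof.
move=> t1 C0 /(_ ((1 + s * t)%:C * expi t)).
rewrite rnormM rnorm_expi mulr1 rnorm_real ger0_norm ?(ltW r0)//.
rewrite ltrDl st0 => /(_ isT).
rewrite /spiral -mulrBl -rmorphB rnormM rnorm_expi mulr1 rnorm_real.
have dist : `|1 + s * t - (1 + s * t)^-1| <= 2 * (s * t).
  have V := mulVf (lt0r_neq0 r0); have V0 : 0 < (1 + s * t)^-1 by rewrite invr_gt0.
  have V1 : (1 + s * t)^-1 <= 1 by rewrite invf_le1// lerDl ltW.
  rewrite ger0_norm; last by have := st0; lra.
  by have := st0; nra.
have far : t / 2 <= rnorm ((1 + s * t)%:C * expi t - 1).
  have := ler_Im_rnorm ((1 + s * t)%:C * expi t - 1) => /=.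
  rewrite mul0r addr0 subr0; apply: le_trans.
  have sint := sin_ge (ltW t0).
  have t3 : t ^+ 3 <= t by rewrite -[leRHS]expr1 ler_wiXn2l// ltW.
  have sin0 : t / 2 <= sin t.
    by move: sint t3; move: (t ^+ 3) (sin t) => u v; lra.
  have sin1 : 0 <= sin t by rewrite (le_trans _ sin0)// divr_ge0// ltW.
  by apply: le_trans (ler_norm _); have := mulr_ge0 (ltW st0) sin1; lra.
move=> H; have := le_trans far H; move: dist; set u := `|_| => dist.
have Cu : C * u <= C * (2 * (s * t)) by rewrite ler_wpM2l.
move=> /le_trans/(_ Cu) => h.
by rewrite -(ler_pM2r t0); lra.
Qed.

End spiral.

Lemma pos_inf_of_eventually (f : nat -> R) K a : 0 < a ->
  (forall k, (K <= k)%N -> a <= f k) -> (forall k, 0 < f k) ->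
  exists2 b, 0 < b & forall k, b <= f k.
Proof.
move=> a0 fa f0; elim: K a a0 fa => [|K IHK] a a0 fa.
  by exists a => // k; exact: fa.
apply: (IHK (Num.min a (f K))) => [|k]; first by rewrite lt_min a0 f0.
rewrite leq_eqVlt => /predU1P[<-|Kk]; first by rewrite ge_min lexx orbT.
by rewrite ge_min fa.
Qed.

(** If [alpha R N] is at most [q], the diagonal operator with eigenvalues
    [spiral (s k) (t k)] is a counterexample, where [s k] tends to 0 and
    [t k < s k / 2] is such that [spiral_powers_near1] applies. *)
Lemma alpha_gt_of_ell2_criterion (N : set nat) q : 1 < q ->
  (forall T : ell2 R -> ell2 R, bounded_op T -> normal_op T ->
     (opnorm T <= 1)%E -> ritt_criterion N q T) ->
  (q%:E < alpha R N)%E.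
Proof.
move=> q1 crit; apply: contrapT => nalpha.
have q10 : 0 < q - 1 by rewrite subr_gt0.
pose s k : R := k.+1%:R^-1.
have s0 k : 0 < s k by rewrite invr_gt0.
have s1 k : s k <= 1 by rewrite invf_le1// ler1n.
have /choice[t tP] k : exists t, [/\ 0 < t, t < s k / 2 &
    hN N (s k * (q - 1))^-1 t < q + s k * (q - 1)].
  have [||t /andP[t0 td] th] := @alpha_le R N q (s k * (q - 1))^-1
    (s k * (q - 1)) (s k / 2) nalpha.
  - by rewrite mulr_gt0.
  - by rewrite divr_gt0.
  by exists t.
have t0 k : 0 < t k by have [] := tP k.
pose w k := spiral (s k) (t k).
have w1 k : rnorm (w k) <= 1 by rewrite ltW// rnorm_spiral_lt1.
have wto1 k : rnorm (1 - w k) <= s k.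
  apply: le_trans (rnorm_1Bspiral (s0 k) (t0 k)) _.
  have [_ tk _] := tP k; have := s1 k; have := t0 k; nra.
pose T := diag_op w; have bT : bounded_op T := diag_op_bounded w1.
have small e : 0 < e -> exists K, forall k, (K <= k)%N -> s k <= e.
  move=> e0; exists (Num.truncn e^-1) => k Kk.
  rewrite invf_ple ?posrE// ltW// (lt_le_trans (truncnS_gt _))// ler_nat ltnS//.
have rT : ritt T.
  apply: (crit T) => //; first exact: diag_op_normal w1.
  - by apply: opnorm_le => // x; exact: diag_op_le.
  - apply: ge_ereal_sup => _ [n Nn <-].
    have q0 : 0 <= q by rewrite (le_trans ler01)// ltW.
    apply: opnorm_le => // x; apply: ell2_norm_dominated => // k.
    rewrite -[(x - _) k]/(x k - iter n T x k) (iter_diag_op _ _ _ w1).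
    rewrite -[x in x - _]mul1r -mulrBl rnormM ler_wpM2r ?rnorm_ge0//.
    by have [_ _ hk] := tP k; exact: spiral_powers_near1 hk n Nn.
  move=> l [specl /= l1]; apply: contrapT => ln1.
  have d0 : 0 < rnorm (l - 1) by rewrite rnorm_gt0 subr_eq0; apply/eqP.
  have [K sK] := small (rnorm (l - 1) / 2) (divr_gt0 d0 (ltr0n _ 2)).
  have [||b b0 lb] := @pos_inf_of_eventually (fun k => rnorm (l - w k)) K
    (rnorm (l - 1) / 2) (divr_gt0 d0 (ltr0n _ 2)).
  - move=> k /sK sk; have := rnorm_triangle l (w k) 1.
    have := wto1 k; rewrite (rnormB_sym (1 : R[i])); lra.
  - move=> k; have := lerB_rnorm l (w k); rewrite l1.
    by have := rnorm_spiral_lt1 (s0 k) (t0 k); rewrite -/(w k); lra.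
  exact: diag_op_spectrum w1 b0 lb specl.
have [C C0 lowT] := lower_bound_of_ritt rT.
have C5 : 0 < (4 * C + 1)^-1 by rewrite invr_gt0 ltr_wpDl// mulr_ge0.
have [K /(_ K (leqnn K)) sK] := small _ C5.
have tK1 : t K <= 1 by have [_ tk _] := tP K; have := s1 K; lra.
have : 1 <= 4 * C * s K.
  apply: (spiral_not_ritt (s0 K) (t0 K) tK1 C0) => l l1.
  have [x x0 Tx] := diag_op_eigenvector K w1.
  have := lowT l x l1; rewrite /T Tx -scalerBl rnormZ mulrA.
  by rewrite ler_pM2r.
have : 4 * C * s K <= 4 * C * (4 * C + 1)^-1 by rewrite ler_wpM2l// mulr_ge0.
have : (4 * C + 1) * (4 * C + 1)^-1 = 1.
  by rewrite divff// gt_eqF// ltr_wpDl// mulr_ge0.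
lra.
Qed.

End counterexample.

Theorem theoremE (R : realType) (nk : nat -> nat)
    (nk_gt0 : forall k, (0 < nk k)%N)
    (nk_incr : {homo nk : i j / (i < j)%N})
    (q : R) (hq : 1 < q < 2) :
  let N : set nat := range nk in
  [<-> forall (X : completeNormedModType R[i]) (T : X -> X),
         bounded_op T -> power_bounded T -> ritt_criterion N q T;
       forall T : ell2 R -> ell2 R,
         bounded_op T -> normal_op T -> (opnorm T <= 1)%E ->
         ritt_criterion N q T;
       (q%:E < alpha R N)%E].
Proof.
move=> N; have /andP[q1 _] := hq; tfae.
- move=> crit T bT _ T1; apply: crit => //; have [lT _] := bT.
  apply: (power_bounded_intro ler01) => n x; rewrite mul1r.
  elim: n => [//|n IHn]; apply: le_trans IHn; rewrite iterS -[leRHS]mul1r.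
  exact: opnorm_bound.
- exact: alpha_gt_of_ell2_criterion.
move=> /(alpha_gt (ltW (lt_trans ltr01 q1)))[B [c [t0 [qc t0_gt0 esc]]]].
move=> X T [lT _] pT TN specT.
have [M M0 TM] := power_bounded_bound lT pT.
have TN' n x : N n -> rnorm (x - iter n T x) <= q * rnorm x.
  have lD : linear (fun y => y - iter n T y).
    have := @linear_lB _ _ (iter n T) 1 (linear_iter n lT).
    by under eq_fun do rewrite scale1r.
  move=> Nn; apply: (opnorm_bound _ lD); apply: le_trans TN.
  by apply: ereal_sup_ubound; exists n.
exact: (ritt_of_escape lT M0 TM TN' qc t0_gt0 esc specT).
Qed.
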